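(* Let $Z_1,\ldots,Z_N$ be a complex-valued martingale difference sequence, i.e. $\mathbb{E}[Z_1]=0$ and $\mathbb{E}[Z_{n+1}\mid Z_1,\ldots,Z_n]=0$ for $1\le n\le N-1$, and put $S_N=\sum_{n=1}^N Z_n$. Assume $\mathbb{E}[|Z_n|^4]$ exists for each $n$. Then for all real $t_1,t_2$, with $t^2=(t_1^2+t_2^2)/2$, $$\begin{aligned}\mathbb{E}\big[e^{it_1\mathrm{Re}(S_N)+it_2\mathrm{Im}(S_N)}\big]&=e^{-t^2/2}+O\Big(e^{t^2}\Big(\sum_{n=1}^N\mathbb{E}[|Z_n|^4]\Big)^{1/4}\Big)+O\Big(e^{t^2}\Big(\mathbb{E}\Big[\Big(\sum_{n=1}^N|Z_n|^2-1\Big)^2\Big]\Big)^{1/2}\Big)\\&\quad+O\Big(e^{t^2}\max_{\phi\in\mathbb{R}}\Big(\mathbb{E}\Big[\Big(\sum_{n=1}^N\big(e^{-i\phi}Z_n^2+e^{i\phi}\overline{Z_n}^2\big)\Big)^2\Big]\Big)^{1/2}\Big),\end{aligned}$$ with absolute implied constants. *)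

(* Defs.v *)
From HB Require Import structures.
From mathcomp Require Import all_boot all_order all_algebra.
From mathcomp Require Import all_classical all_reals all_analysis.
From mathcomp Require Export complex.

Set Implicit Arguments.
Unset Strict Implicit.
Unset Printing Implicit Defensive.

Import Order.TTheory GRing.Theory Num.Theory.
Import numFieldNormedType.Exports.

Local Open Scope classical_set_scope.
Local Open Scope ring_scope.
Local Open Scope complex_scope.

(* The library norm `|z| on R[i] is R[i]-valued; this is the real modulus. *)
Definition modc (R : realType) (z : R[i]) : R := ComplexField.Normc.normc z.

Definition expC (R : realType) (z : R[i]) : R[i] :=
  (expR (complex.Re z))%:C * (cos (complex.Im z) +i* sin (complex.Im z)).

Definition is_maximum (R : realType) (A : set R) (m : R) : Prop :=
  A m /\ ubound A m.

Section complex_random_variables.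
Context (R : realType) (d : measure_display) (T : measurableType d).
Variable P : probability T R.

(* [integrable] includes measurability. *)
Definition cintegrable (X : T -> R[i]) : Prop :=
  P.-integrable [set: T] (EFin \o (@complex.Re R \o X)) /\
  P.-integrable [set: T] (EFin \o (@complex.Im R \o X)).

Definition cintegral (A : set T) (X : T -> R[i]) : R[i] :=
  (\int[P]_(w in A) complex.Re (X w)) +i* (\int[P]_(w in A) complex.Im (X w)).

Definition cexpectation (X : T -> R[i]) : R[i] :=
  fine 'E_P[@complex.Re R \o X] +i* fine 'E_P[@complex.Im R \o X].

(* The preimages under X of {z | Re z in B} and {z | Im z in B}, B Borel: these
   cylinders generate the Borel sets of the complex plane. *)
Definition cpreimages (X : T -> R[i]) : set (set T) :=
  preimage_set_system [set: T] (@complex.Re R \o X) measurable `|`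
  preimage_set_system [set: T] (@complex.Im R \o X) measurable.

(* sigma(Z_1, ..., Z_n) *)
Definition sigma_upto (Z : nat -> T -> R[i]) (n : nat) : set (set T) :=
  <<s \bigcup_(k in [set k | (1 <= k <= n)%N]) cpreimages (Z k) >>.

(* Y is a version of E[X | G], for G a sub-sigma-algebra of the events. *)
Definition is_cond_expectation (G : set (set T)) (X Y : T -> R[i]) : Prop :=
  [/\ cintegrable X, cintegrable Y, cpreimages Y `<=` G &
      forall A, G A -> cintegral A Y = cintegral A X].

Definition martingale_difference (N : nat) (Z : nat -> T -> R[i]) : Prop :=
  [/\ forall n, (1 <= n <= N)%N -> cintegrable (Z n),
      cexpectation (Z 1%N) = 0 &
      forall n, (1 <= n <= N.-1)%N ->
        is_cond_expectation (sigma_upto Z n) (Z n.+1) (cst 0)].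

(* The expectation below is that of the square of a sum of numbers w + w^*, so
   it is real and [Re] discards nothing. *)
Definition phase_term (N : nat) (Z : nat -> T -> R[i]) (phi : R) : R :=
  Num.sqrt (complex.Re (cexpectation (fun w =>
    (\sum_(1 <= n < N.+1) (expC (- phi)*i * Z n w ^+ 2
                          + expC phi*i * conjc (Z n w) ^+ 2)) ^+ 2))).

End complex_random_variables.

(* Main.v *)
(* The proof works with the real martingale differences
   [X_n = t1 * Re Z_n + t2 * Im Z_n], with partial sums [S_n] and quadratic
   variation [V_n = X_1^2 + ... + X_n^2].  The process [exp (i S_n + V_n / 2)] is
   a martingale up to third-order errors.  Its modulus is kept bounded by
   [exp t^2] without any stopping time, by replacing [exp (v / 2)] by
   [exp (min (v, 2 t^2) / 2)]; the price is paid only where [V_N > 2 t^2], and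
   there [V_N <= 2 |V_N - t^2|].  This gives a pointwise inequality comparing
   [exp (t^2 / 2) exp (i S_N)] with [1], up to a sum of martingale differences,
   with error [exp t^2] times [O(sum |X_n|^3 + |V_N - t^2|)].

   Taking expectations kills the martingale differences.  For a suitable angle
   [phi] one has [V_N - t^2 = t^2 (sum |Z_n|^2 - 1) + t^2 / 2 * Phi], where [Phi]
   is the sum in the phase term at [phi], and Cauchy-Schwarz gives the second and
   third error terms.  The cubic sum is split by
   [2 |x|^3 <= lam x^2 + x^4 / lam] with [lam] slightly above
   [(sum E |Z_n|^4) ^ (1/4)].  The real and imaginary parts are the cases
   [s = 0] and [s = - pi / 2] of an estimate for [E cos (s + S_N)].  *)

Require Import Defs.
From HB Require Import structures.
From mathcomp Require Import all_boot all_order all_algebra.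
From mathcomp Require Import all_classical all_reals all_analysis.
From mathcomp Require Import complex.
From mathcomp Require Import measurable_realfun ring lra.

Set Implicit Arguments.
Unset Strict Implicit.
Unset Printing Implicit Defensive.

Import Order.TTheory GRing.Theory Num.Theory.
Import numFieldNormedType.Exports.

Local Open Scope classical_set_scope.
Local Open Scope ring_scope.
Local Open Scope complex_scope.

(** * Trigonometric estimates *)

Section deterministic.
Context {R : realType}.
Implicit Types t x y u v w a c s p q : R.

Lemma sin_id_le x : 0 <= x -> sin x <= x.
Proof.
move=> x0.
have [|z _] := @MVT_segment R sin cos 0 x x0 (fun y _ => is_derive_sin y).
  by move=> y; exact: continuous_subspaceT (@continuous_sin R) y.
by rewrite sin0 !subr0 => ->; rewrite -[leRHS]mul1r ler_wpM2r ?cos_le1.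
Qed.

Lemma normr_sin_le x : `|sin x| <= `|x|.
Proof.
wlog x0 : x / 0 <= x => [H|].
  have [/H//|/ltW x0] := leP 0 x.
  by have := H (- x); rewrite sinN !normrN oppr_ge0; exact.
have [x1|x1] := leP x 1; last first.
  by rewrite (le_trans (sin_max _))// ger0_norm// ltW.
rewrite !ger0_norm ?sin_id_le//.
apply: sin_ge0_pi; rewrite x0/= (le_trans x1)//.
by rewrite (le_trans _ (pi_ge2 R))// ler1n.
Qed.

Lemma onem_cos_le x : 1 - cos x <= x ^+ 2 / 2.
Proof.
have -> : 1 - cos x = 2 * sin (x / 2) ^+ 2.
  have -> : cos x = cos (x / 2 + x / 2) by congr cos; field.
  by rewrite cosD -!expr2 sin2cos2; ring.
have : sin (x / 2) ^+ 2 <= (x / 2) ^+ 2.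
  by rewrite -ler_sqrt ?sqr_ge0// !sqrtr_sqr normr_sin_le.
lra.
Qed.

(** By the mean value theorem [sin x - x = - (1 - cos z) * x] with [z] between [0] and [x], and
    [1 - cos z] is at most [x ^+ 2 / 2]. *)
Lemma sin_taylor1 x : `|sin x - x| <= `|x| ^+ 3 / 2.
Proof.
wlog x0 : x / 0 <= x => [H|].
  have [/H//|/ltW x0] := leP 0 x.
  by have := H (- x); rewrite sinN -opprD !normrN oppr_ge0; exact.
have [|z zx] := @MVT_segment R sin cos 0 x x0 (fun y _ => is_derive_sin y).
  by move=> y; exact: continuous_subspaceT (@continuous_sin R) y.
rewrite sin0 !subr0 => ->.
have -> : cos z * x - x = - ((1 - cos z) * x) by ring.
rewrite normrN normrM (ger0_norm x0) ger0_norm ?subr_ge0 ?cos_le1//.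
have -> : x ^+ 3 / 2 = (x ^+ 2 / 2) * x by field.
rewrite ler_wpM2r// (le_trans (onem_cos_le z))// ler_wpM2r// lerXn2r ?nnegrE//;
  by move: zx; rewrite in_itv/= => /andP[].
Qed.

(** With [y = x / 2] the error is [- 2 (sin y - y) (sin y + y)]: the first factor is cubic by
    [sin_taylor1], the second at most [2 |y|]. *)
Lemma cos_taylor2 x : `|cos x - (1 - x ^+ 2 / 2)| <= x ^+ 4 / 8.
Proof.
have -> : cos x = 1 - 2 * sin (x / 2) ^+ 2.
  have -> : cos x = cos (x / 2 + x / 2) by congr cos; field.
  by rewrite cosD -!expr2 cos2sin2; ring.
set y := x / 2; have -> : x = 2 * y by rewrite /y; field.
have -> : 1 - 2 * sin y ^+ 2 - (1 - (2 * y) ^+ 2 / 2)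
    = - (2 * ((sin y - y) * (sin y + y))) by field.
rewrite normrN !normrM ger0_norm//.
have -> : (2 * y) ^+ 4 / 8 = 2 * ((`|y| ^+ 3 / 2) * (`|y| + `|y|)).
  have -> : (2 * y) ^+ 4 / 8 = 2 * (y ^+ 2) ^+ 2 by field.
  by rewrite -(real_normK (num_real y)); field.
rewrite ler_wpM2l// ler_pM// ?sin_taylor1// (le_trans (ler_normD _ _))//.
by rewrite lerD2r normr_sin_le.
Qed.

(** The upper bound goes through [exp (- y) <= 1 / (1 + y) <= 1 - y + y ^+ 2]. *)
Lemma expRN_taylor1 y : 0 <= y -> `|expR (- y) - (1 - y)| <= y ^+ 2.
Proof.
move=> y0; have h1 := expR_ge1Dx (- y); have h2 := expR_ge1Dx y.
rewrite ger0_norm; last by lra.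
have h3 : expR (- y) * (1 + y) <= 1.
  by rewrite -[leRHS](expR0 R) -[in leRHS](addNr y) expRD ler_wpM2l ?expR_ge0.
have y1 : 0 < 1 + y by lra.
have : expR (- y) <= (1 + y)^-1.
  by rewrite -[leRHS]mul1r ler_pdivlMr.
have : (1 + y)^-1 <= 1 - y + y ^+ 2.
  rewrite -[leLHS]mul1r ler_pdivrMr; last by lra.
  have := exprn_ge0 3 y0; nra.
lra.
Qed.

(** Together with [sin_gauss] this says [exp (i x) = (1 + i x) exp (- x ^+ 2 / 2) + O(|x| ^+ 3)] for
    every real [x]. For [|x| <= 1] both Taylor errors are quartic; for [|x| > 1] the left side is at
    most 2. *)
Lemma cos_gauss x : `|cos x - expR (- (x ^+ 2 / 2))| <= 2 * `|x| ^+ 3.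
Proof.
have [x1|x1] := leP `|x| 1; last first.
  rewrite (le_trans (ler_normB _ _))//.
  have := exprn_ege1 3 (ltW x1); have := cos_max x.
  have : `|expR (- (x ^+ 2 / 2))| <= 1.
    by rewrite ger0_norm ?expR_ge0// -(expR0 R) ler_expR oppr_le0 divr_ge0// sqr_ge0.
  lra.
have -> : cos x - expR (- (x ^+ 2 / 2)) = (cos x - (1 - x ^+ 2 / 2)) -
   (expR (- (x ^+ 2 / 2)) - (1 - x ^+ 2 / 2)) by ring.
rewrite (le_trans (ler_normB _ _))//.
have y0 : 0 <= x ^+ 2 / 2 by rewrite divr_ge0// sqr_ge0.
have h1 := cos_taylor2 x; have h2 := expRN_taylor1 y0.
have x4 : x ^+ 4 <= `|x| ^+ 3.
  have -> : x ^+ 4 = `|x| ^+ 3 * `|x|.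
    have -> : x ^+ 4 = (x ^+ 2) ^+ 2 by ring.
    by rewrite -(real_normK (num_real x)); ring.
  by rewrite ler_piMr// exprn_ge0.
have -> : (2 * `|x| ^+ 3) = `|x| ^+ 3 + `|x| ^+ 3 by ring.
have e : (x ^+ 2 / 2) ^+ 2 = x ^+ 4 / 4 by field.
rewrite e in h2.
have := exprn_ge0 3 (normr_ge0 x).
lra.
Qed.

Lemma sin_gauss x : `|sin x - x * expR (- (x ^+ 2 / 2))| <= `|x| ^+ 3.
Proof.
have y0 : 0 <= x ^+ 2 / 2 by rewrite divr_ge0// sqr_ge0.
have -> : sin x - x * expR (- (x ^+ 2 / 2)) =
   (sin x - x) + x * (1 - expR (- (x ^+ 2 / 2))) by ring.
rewrite (le_trans (ler_normD _ _))// normrM.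
have h : `|1 - expR (- (x ^+ 2 / 2))| <= x ^+ 2 / 2.
  rewrite ger0_norm; first by have := expR_ge1Dx (- (x ^+ 2 / 2)); lra.
  by rewrite subr_ge0 -[leRHS](expR0 R) ler_expR oppr_le0.
have := sin_taylor1 x.
have : `|x| * `|1 - expR (- (x ^+ 2 / 2))| <= `|x| ^+ 3 / 2.
  apply: (le_trans (ler_wpM2l (normr_ge0 _) h)).
  by rewrite -(real_normK (num_real x)) le_eqVlt; apply/orP; left; apply/eqP; field.
lra.
Qed.

(** * The capped exponential and the pathwise estimate *)

Definition capexp c v := expR (Num.min v c / 2).

Lemma capexp_ge0 c v : 0 <= capexp c v.
Proof. exact: expR_ge0. Qed.

Lemma capexp_le c v : capexp c v <= expR (c / 2).
Proof. by rewrite ler_expR ler_wpM2r// ge_min lexx orbT. Qed.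

Lemma expR_half_lip c p q : p <= q -> q <= c ->
  `|expR (q / 2) - expR (p / 2)| <= expR (c / 2) * (q - p) / 2.
Proof.
move=> pq qc; have -> : expR (q / 2) - expR (p / 2) =
    expR (q / 2) * (1 - expR (- ((q - p) / 2))).
  by rewrite mulrBr mulr1 -expRD; congr (_ - expR _); field.
rewrite normrM ger0_norm ?expR_ge0// -mulrA ler_pM ?ler_expR ?ler_wpM2r//.
rewrite ger0_norm; first by have := expR_ge1Dx (- ((q - p) / 2)); lra.
by rewrite subr_ge0 -(expR0 R) ler_expR oppr_le0 divr_ge0// subr_ge0.
Qed.

(** Truncation at [c] is a contraction, and on values up to [c] the map [v |-> exp (v / 2)] has
    slope at most [exp (c / 2) / 2]. *)
Lemma capexp_lip c v w : `|capexp c v - capexp c w| <= expR (c / 2) * `|v - w| / 2.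
Proof.
wlog wv : v w / w <= v => [H|].
  by have [/H//|/ltW/H] := leP w v; rewrite distrC (distrC w).
have mm : Num.min w c <= Num.min v c by rewrite le_min !ge_min wv lexx orbT.
apply: (le_trans (expR_half_lip mm (_ : _ <= c))); first by rewrite ge_min lexx orbT.
rewrite ler_wpM2r// ler_wpM2l ?expR_ge0//.
rewrite ger0_norm ?subr_ge0//.
by rewrite /Order.min; case: (ltP w c) => ?; case: (ltP v c) => ?; lra.
Qed.

(* Below the cap the second-order terms cancel:
   [exp (i x + x ^+ 2 / 2) = 1 + i x + O(`|x| ^+ 3)]. *)
Lemma cos_capexp_step c u v x :
  `|cos (u + x) * capexp c (v + x ^+ 2) - cos u * capexp c v + x * (sin u * capexp c v)|
  <= expR (c / 2) * (3 * `|x| ^+ 3 + (c < v + x ^+ 2)%R%:R * x ^+ 2).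
Proof.
have x3 := exprn_ge0 3 (normr_ge0 x).
have x2 := sqr_ge0 x.
rewrite cosD; case: ltP => vc /=; last first.
  rewrite mul0r addr0.
  have vc' : v <= c by apply: le_trans vc; rewrite lerDl.
  (* Below the cap, factoring out the new value of the capped exponential leaves exactly the
     differences bounded by [cos_gauss] and [sin_gauss]. *)
  have e : capexp c v = capexp c (v + x ^+ 2) * expR (- (x ^+ 2 / 2)).
    by rewrite /capexp !min_l// -expRD; congr expR; field.
  have -> : (cos u * cos x - sin u * sin x) * capexp c (v + x ^+ 2) - cos u * capexp c v +
      x * (sin u * capexp c v) = capexp c (v + x ^+ 2) *
      (cos u * (cos x - expR (- (x ^+ 2 / 2))) - sin u * (sin x - x * expR (- (x ^+ 2 / 2)))).
    by rewrite e; ring.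
  rewrite normrM ger0_norm ?capexp_ge0// ler_pM ?capexp_ge0 ?capexp_le//.
  rewrite (le_trans (ler_normB _ _))// !normrM.
  have h1 := ler_pM (normr_ge0 _) (normr_ge0 _) (cos_max u) (cos_gauss x).
  have h2 := ler_pM (normr_ge0 _) (normr_ge0 _) (sin_max u) (sin_gauss x).
  lra.
(* Once the cap is exceeded there is no cancellation. The cost [x ^+ 2] is one half from the
   Lipschitz bound on [capexp] and one half from [1 - cos x]. *)
rewrite -cosD mul1r.
have -> : cos (u + x) * capexp c (v + x ^+ 2) - cos u * capexp c v +
    x * (sin u * capexp c v) = cos (u + x) * (capexp c (v + x ^+ 2) - capexp c v) +
    capexp c v * (cos u * (cos x - 1) - sin u * (sin x - x)).
  by rewrite cosD; ring.
rewrite (le_trans (ler_normD _ _))// !normrM.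
have h1 := ler_pM (normr_ge0 _) (normr_ge0 _) (cos_max (u + x)) (capexp_lip c (v + x ^+ 2) v).
rewrite addrAC subrr add0r (ger0_norm x2) in h1.
have -> : expR (c / 2) * (3 * `|x| ^+ 3 + x ^+ 2) = 1 * (expR (c / 2) * x ^+ 2 / 2) +
   expR (c / 2) * (3 * `|x| ^+ 3 + x ^+ 2 / 2) by field.
apply: lerD => //; rewrite (ger0_norm (capexp_ge0 _ _)).
apply: ler_pM; rewrite ?capexp_ge0 ?capexp_le// (le_trans (ler_normB _ _))// !normrM.
have hc : `|cos x - 1| <= x ^+ 2 / 2.
  by rewrite distrC ger0_norm ?subr_ge0 ?cos_le1// onem_cos_le.
have h2 := ler_pM (normr_ge0 _) (normr_ge0 _) (cos_max u) hc.
have h3 := ler_pM (normr_ge0 _) (normr_ge0 _) (sin_max u) (sin_taylor1 x).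
lra.
Qed.

(** This is [cos_capexp_step] telescoped. The coefficient of [X k] depends only on the [X j] with
    [j < k], so the subtracted sum is a martingale transform and will have mean zero. The shift [a]
    lets one statement serve cosine and sine. *)
Lemma cos_sum_capexp c a (X : nat -> R) n :
  `|cos (a + \sum_(1 <= k < n.+1) X k) * capexp c (\sum_(1 <= k < n.+1) X k ^+ 2)
    - cos a * capexp c 0
    + \sum_(1 <= k < n.+1) X k * (sin (a + \sum_(1 <= j < k) X j) *
         capexp c (\sum_(1 <= j < k) X j ^+ 2))|
  <= expR (c / 2) * \sum_(1 <= k < n.+1) (3 * `|X k| ^+ 3 +
         (c < \sum_(1 <= j < k.+1) X j ^+ 2)%R%:R * X k ^+ 2).
Proof.
elim: n => [|n IH]; first by rewrite !big_geq// !addr0 subrr normr0 mulr0.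
rewrite !(big_nat_recr n.+1)//= mulrDr.
set S := \sum_(1 <= k < n.+1) X k in IH *.
set V := \sum_(1 <= k < n.+1) X k ^+ 2 in IH *.
have := lerD IH (cos_capexp_step c (a + S) V (X n.+1)).
apply: le_trans; apply: le_trans (ler_normD _ _).
by rewrite le_eqVlt; apply/orP; left; apply/eqP; congr `|_|; rewrite [a + (S + _)]addrA; ring.
Qed.

(* The cap is [2 t], so that [V <= 2 |V - t|] wherever it is exceeded. *)
Lemma cos_sum_approx t a (X : nat -> R) n : 0 <= t ->
  `|expR (t / 2) * cos (a + \sum_(1 <= k < n.+1) X k) - cos a
    + \sum_(1 <= k < n.+1) X k * (sin (a + \sum_(1 <= j < k) X j) *
         capexp (2 * t) (\sum_(1 <= j < k) X j ^+ 2))|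
  <= expR t * (3 * (\sum_(1 <= k < n.+1) `|X k| ^+ 3) + 5 / 2 * `|\sum_(1 <= k < n.+1) X k ^+ 2 - t|).
Proof.
move=> t0; set V := \sum_(1 <= k < n.+1) X k ^+ 2.
have e2 : 2 * t / 2 = t by field.
have := @cos_sum_capexp (2 * t) a X n.
rewrite {2}/capexp min_l ?mulr_ge0// mul0r expR0 mulr1 e2 -/V.
set S := \sum_(1 <= k < n.+1) X k.
set Y := \sum_(1 <= k < n.+1) X k * _ => h.
(* Since [t <= 2 * t], [expR (t / 2)] is itself the capped exponential at [t]; putting it in place
   of the value at [V] costs [|V - t| / 2]. With the factor 2 of [h3] this makes up the [5 / 2]. *)
have h2 : `|(expR (t / 2) - capexp (2 * t) V) * cos (a + S)| <= expR t * (`|V - t| / 2).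
  rewrite normrM.
  have et : expR (t / 2) = capexp (2 * t) t by rewrite /capexp min_l//; lra.
  rewrite et; have := capexp_lip (2 * t) t V; rewrite e2 distrC => hl.
  have := ler_pM (normr_ge0 _) (normr_ge0 _) hl (cos_max (a + S)).
  by rewrite distrC (distrC t) mulr1 mulrA.
have h3 : \sum_(1 <= k < n.+1) (3 * `|X k| ^+ 3 +
         (2 * t < \sum_(1 <= j < k.+1) X j ^+ 2)%R%:R * X k ^+ 2) <=
    3 * (\sum_(1 <= k < n.+1) `|X k| ^+ 3) + 2 * `|V - t|.
  rewrite big_split/= mulr_sumr lerD2l.
  (* The partial sums of squares increase, so if [V <= 2 * t] every indicator vanishes; otherwise
     the indicator sum is at most [V], hence at most [2 * |V - t|]. *)
  have [Vt|Vt] := ltP (2 * t) V; last first.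
    rewrite big_nat big1 ?mulr_ge0// => k /andP[k1 kn].
    rewrite ltNge (le_trans _ Vt) ?mul0r//.
    rewrite /V [leRHS](big_cat_nat (n := k.+1))//= lerDl sumr_ge0// => i _; exact: sqr_ge0.
  apply: (@le_trans _ _ V); last by have := ler_norm (V - t); lra.
  apply: ler_sum => k _; rewrite -[leRHS]mul1r ler_wpM2r ?sqr_ge0//.
  by case: (_ < _).
have h4 := ler_wpM2l (expR_ge0 t) h3.
have := lerD (le_trans h h4) h2.
have -> : expR t * (3 * (\sum_(1 <= k < n.+1) `|X k| ^+ 3) + 2 * `|V - t|) + expR t * (`|V - t| / 2)
   = expR t * (3 * (\sum_(1 <= k < n.+1) `|X k| ^+ 3) + 5 / 2 * `|V - t|) by field.
apply: le_trans; apply: le_trans (ler_normD _ _).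
by rewrite le_eqVlt; apply/orP; left; apply/eqP; congr `|_|; ring.
Qed.

(** * Polar angles and maxima of trigonometric quadratic forms *)

Lemma polar_angle u v : exists phi,
  u = Num.sqrt (u ^+ 2 + v ^+ 2) * cos phi /\ v = Num.sqrt (u ^+ 2 + v ^+ 2) * sin phi.
Proof.
set r := Num.sqrt _.
have r2 : r ^+ 2 = u ^+ 2 + v ^+ 2 by rewrite sqr_sqrtr// addr_ge0// sqr_ge0.
have [r0|r0] := eqVneq r 0.
  exists 0; move/eqP: r2; rewrite r0 expr0n/= eq_sym paddr_eq0 ?sqr_ge0// !sqrf_eq0.
  by rewrite !mul0r => /andP[/eqP -> /eqP ->].
have rp : 0 < r by rewrite lt_neqAle eq_sym r0 sqrtr_ge0.
have hu : -1 <= u / r <= 1.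
  rewrite -ler_norml normrM normfV (ger0_norm (ltW rp)) ler_pdivrMr// mul1r.
  by rewrite -sqrtr_sqr ler_wsqrtr// lerDl sqr_ge0.
have e : Num.sqrt (1 - (u / r) ^+ 2) = `|v| / r.
  have -> : 1 - (u / r) ^+ 2 = (v / r) ^+ 2.
    apply: (mulIf (expf_neq0 2 r0)).
    by rewrite mulrBl mul1r !expr_div_n !divfK ?expf_neq0// r2; ring.
  by rewrite sqrtr_sqr normrM normfV (ger0_norm (ltW rp)).
have cu : cos (acos (u / r)) = u / r by rewrite acosK// in_itv.
have su := sin_acos hu; rewrite e in su.
(* [acos] only yields angles with nonnegative sine, so the angle is negated when [v < 0]. *)
have [v0|v0] := leP 0 v.
  exists (acos (u / r)); rewrite cu su ger0_norm//; split; field; exact: r0.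
by exists (- acos (u / r)); rewrite cosN sinN cu su ltr0_norm//; split; field; exact: r0.
Qed.

(** In the doubled angle the form is [(p + r) / 2 + rho * cos (2 phi - psi)] with [rho >= 0], which
    is largest at [phi = psi / 2]. *)
Lemma quadratic_form_max p q r : exists phi0, forall phi,
  p * cos phi ^+ 2 + 2 * q * (cos phi * sin phi) + r * sin phi ^+ 2 <=
  p * cos phi0 ^+ 2 + 2 * q * (cos phi0 * sin phi0) + r * sin phi0 ^+ 2.
Proof.
have double phi : p * cos phi ^+ 2 + 2 * q * (cos phi * sin phi) + r * sin phi ^+ 2 =
    (p + r) / 2 + ((p - r) / 2 * cos (phi + phi) + q * sin (phi + phi)).
  rewrite cosD sinD -!expr2.
  have -> : (p + r) / 2 = (p + r) / 2 * (cos phi ^+ 2 + sin phi ^+ 2).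
    by rewrite cos2Dsin2 mulr1.
  by field.
have [psi [hc hs]] := polar_angle ((p - r) / 2) q.
exists (psi / 2) => phi; rewrite !double lerD2l.
set rho := Num.sqrt _ in hc hs; have rho0 : 0 <= rho by exact: sqrtr_ge0.
rewrite (_ : psi / 2 + psi / 2 = psi); last by field.
rewrite hc hs -!mulrA -!mulrDr ler_wpM2l//.
have -> : cos psi * cos psi + sin psi * sin psi = 1 by rewrite -!expr2 cos2Dsin2.
by rewrite -cosB cos_le1.
Qed.

End deterministic.

(** * Integration against a probability *)

Section real_integration.
Context {R : realType} {d : measure_display} {T : measurableType d}.
Variable P : probability T R.
Implicit Types f g : T -> R.

Local Notation intg f := (P.-integrable [set: T] (EFin \o f)).

Lemma integrable_dominated f g : measurable_fun [set: T] f -> intg g ->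
  (forall w, `|f w| <= g w) -> intg f.
Proof.
move=> mf ig fg; apply: (le_integrable measurableT _ _ ig).
  exact/measurable_EFinP.
by move=> w _ /=; rewrite lee_fin (le_trans (fg w))// ler_norm.
Qed.

Lemma integrable_measurable f : intg f -> measurable_fun [set: T] f.
Proof. by move=> /measurable_int /measurable_EFinP. Qed.

Lemma integrable_cstR (k : R) : intg (fun=> k).
Proof. exact: finite_measure_integrable_cst. Qed.

Lemma integrable_addR f g : intg f -> intg g -> intg (fun w => f w + g w).
Proof. by move=> fi gi; exact: (integrableD measurableT fi gi). Qed.

Lemma integrable_subR f g : intg f -> intg g -> intg (fun w => f w - g w).
Proof. by move=> fi gi; exact: (integrableB measurableT fi gi). Qed.

Lemma integrable_scaleR (k : R) f : intg f -> intg (fun w => k * f w).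
Proof. by move=> fi; exact: (integrableZl measurableT k fi). Qed.

Lemma integrable_normR f : intg f -> intg (fun w => `|f w|).
Proof. by move=> fi; exact: integrable_norm. Qed.

Lemma integrable_sum_nat (f : nat -> T -> R) m n :
  (forall k, (m <= k < n)%N -> intg (f k)) ->
  intg (fun w => \sum_(m <= k < n) f k w).
Proof.
move=> fi; have -> : (fun w => \sum_(m <= k < n) f k w) =
    (fun w => \sum_(k <- index_iota m n | k \in index_iota m n) f k w).
  by apply/funext => w; rewrite big_seq.
have -> : EFin \o (fun w => \sum_(k <- index_iota m n | k \in index_iota m n) f k w)
   = (fun w => \sum_(k <- index_iota m n | k \in index_iota m n) (f k w)%:E)%E.
  by apply/funext => w; rewrite /= -sumEFin.
by apply: integrable_sum => // k; rewrite mem_index_iota; exact: fi.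
Qed.

Lemma Rintegral_prob_cst (k : R) : \int[P]_w k = k.
Proof. by rewrite Rintegral_cst//= (@probability_setT _ _ _ P) mulr1. Qed.

Lemma Rintegral_sum_nat (f : nat -> T -> R) m n :
  (forall k, (m <= k < n)%N -> intg (f k)) ->
  \int[P]_w (\sum_(m <= k < n) f k w) = \sum_(m <= k < n) \int[P]_w f k w.
Proof.
have [nm|mn] := leqP n m.
  move=> _; rewrite [RHS]big_geq// -[RHS]Rintegral_prob_cst.
  by apply: eq_Rintegral => w _; rewrite big_geq.
rewrite -(subnKC (ltnW mn)); elim: (n - m)%N => [|k IH] fi.
  rewrite addn0 [RHS]big_geq// -[RHS]Rintegral_prob_cst.
  by apply: eq_Rintegral => w _; rewrite big_geq.
rewrite addnS big_nat_recr ?leq_addr//= -IH; last first.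
  by move=> j /andP[mj jk]; apply: fi; rewrite mj addnS ltnS ltnW.
rewrite -RintegralD//.
- by apply: eq_Rintegral => w _; rewrite big_nat_recr ?leq_addr.
- apply: integrable_sum_nat => j /andP[mj jk].
  by apply: fi; rewrite mj addnS ltnS ltnW.
- by apply: fi; rewrite leq_addr addnS ltnS/=.
Qed.

(** Cauchy-Schwarz against the constant 1. Integrability follows from [|f| <= 1 + f ^+ 2], and the
    bound from integrating [(|f| - I) ^+ 2 >= 0] with [I] the mean of [|f|]. *)
Lemma Rintegral_norm_le_sqrt f : measurable_fun [set: T] f ->
  intg (fun w => f w ^+ 2) ->
  intg f /\ \int[P]_w `|f w| <= Num.sqrt (\int[P]_w f w ^+ 2).
Proof.
move=> mf f2.
have fi : intg f.
  apply: (integrable_dominated mf (integrable_addR (integrable_cstR 1) f2)) => w.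
  by rewrite -(real_normK (num_real (f w))); have := sqr_ge0 (`|f w| - 1); nra.
split=> //; set I := \int[P]_w `|f w|.
have I0 : 0 <= I by exact: Rintegral_ge0.
rewrite -(ger0_norm I0) -sqrtr_sqr ler_wsqrtr//.
have : 0 <= \int[P]_w ((f w ^+ 2 + (- 2 * I) * `|f w|) + I ^+ 2).
  apply: Rintegral_ge0 => w _; rewrite -(real_normK (num_real (f w))).
  by have := sqr_ge0 (`|f w| - I); nra.
have fn := integrable_normR fi.
rewrite RintegralD ?Rintegral_prob_cst//; last 2 first.
- by apply: integrable_addR => //; exact: integrable_scaleR.
- exact: integrable_cstR.
rewrite RintegralD//; last exact: integrable_scaleR.
by rewrite RintegralZl// -/I; nra.
Qed.

Lemma integrable_mul_bounded f g C : intg f -> measurable_fun [set: T] g ->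
  (forall w, `|g w| <= C) -> intg (fun w => f w * g w).
Proof.
move=> fi mg gC.
apply: (integrable_dominated _ (integrable_scaleR C (integrable_normR fi))).
  by apply: measurable_funM => //; exact: integrable_measurable.
by move=> w; rewrite normrM mulrC ler_wpM2r.
Qed.

Lemma integrable_mul_sqr f g :
  measurable_fun [set: T] f -> measurable_fun [set: T] g ->
  intg (fun w => f w ^+ 2) -> intg (fun w => g w ^+ 2) -> intg (fun w => f w * g w).
Proof.
move=> mf mg fi gi; apply: (integrable_dominated _ (integrable_addR fi gi)).
  exact: measurable_funM.
move=> w; rewrite normrM -(real_normK (num_real (f w))) -(real_normK (num_real (g w))).
have := sqr_ge0 (`|f w| - `|g w|); have := sqr_ge0 (`|f w| + `|g w|); nra.
Qed.

(* [Y] is discretised at scale [1 / m]: the discretisation is a finite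
   combination of indicators of events of the sub-sigma-algebra. *)
Lemma Rintegral_mul_eq0 (Gen : set (set T)) (X Y : T -> R) C :
  (forall A, <<s Gen >> A -> measurable A) ->
  intg X -> (forall A, <<s Gen >> A -> \int[P]_(w in A) X w = 0) ->
  measurable_fun [set: g_sigma_algebraType Gen] (Y : g_sigma_algebraType Gen -> R) ->
  (forall w, `|Y w| <= C) ->
  \int[P]_w (X w * Y w) = 0.
Proof.
move=> Gm iX X0 mY YC.
have mYT : measurable_fun [set: T] Y.
  by move=> _ B mB; apply: Gm; exact: (mY measurableT B mB).
have iXY := integrable_mul_bounded iX mYT YC.
set I := \int[P]_w `|X w|.
have I0 : 0 <= I by exact: Rintegral_ge0.
(* A bound by [I / (m + 1)] for all [m] forces the integral to vanish; the contradiction divides by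
   [1 + I], which is positive even if [I = 0]. *)
suff H m : `|\int[P]_w (X w * Y w)| <= m.+1%:R^-1 * I.
  apply/eqP; rewrite -normr_le0 leNgt; apply/negP => e0.
  have [k] := ltr_add_invr (divr_gt0 e0 (ltr_pwDl ltr01 I0)).
  rewrite add0r ltr_pdivlMr ?ltr_pwDl// ltNge => /negP; apply.
  apply: (le_trans (H k)); rewrite ler_wpM2l ?invr_ge0//.
  by rewrite lerDr.
set M := m.+1%:R : R; have M0 : 0 < M by rewrite ltr0n.
(* Half-open cells of width [1 / M] starting at [- C]. Below, [jw w] is the index of the cell
   containing [Y w], and [Ym] rounds [Y] down to the left end of its cell. *)
pose A (j : nat) := Y @^-1` `[j%:R / M - C, j.+1%:R / M - C[%classic.
have GA j : <<s Gen >> (A j).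
  have := mY measurableT `[j%:R / M - C, j.+1%:R / M - C[%classic.
  by rewrite setTI; apply; exact: measurable_itv.
pose jw w := Num.truncn ((Y w + C) * M).
have YC0 w : 0 <= (Y w + C) * M.
  by rewrite mulr_ge0 ?(ltW M0)//; have := YC w; rewrite ler_norml; lra.
have jP w : (jw w)%:R <= (Y w + C) * M < (jw w).+1%:R by exact: truncn_itv.
have jA w j : (w \in A j) = (j == jw w).
  apply/idP/eqP => [|->].
    rewrite inE /A /= in_itv/= lerBlDr ltrBrDr ler_pdivrMr// ltr_pdivlMr// => h.
    by rewrite /jw (truncn_def h).
  by rewrite inE /A /= in_itv/= lerBlDr ltrBrDr ler_pdivrMr// ltr_pdivlMr.
(* [Y w <= C] bounds the cell index by the truncation of [2 * C * M]; the successor makes the bound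
   strict. *)
pose K := (Num.truncn (2 * C * M)).+1.
have jK w : (jw w < K)%N.
  rewrite ltnS /jw le_truncn// ler_wpM2r ?(ltW M0)//.
  by have := YC w; rewrite ler_norml; lra.
pose Ym w := \sum_(0 <= j < K) (j%:R / M - C) * \1_(A j) w.
have YmE w : Ym w = (jw w)%:R / M - C.
  rewrite /Ym big_mkord (bigD1 (Ordinal (jK w)))//= big1 ?addr0.
    by rewrite indicE jA eqxx mulr1.
  move=> i /eqP ij; rewrite indicE jA; case: eqP => [e|]; last by rewrite mulr0.
  by exfalso; apply: ij; apply: val_inj.
have YYm w : `|Y w - Ym w| <= M^-1.
  rewrite YmE; have /andP[h1 h2] := jP w.
  rewrite ger0_norm.
    have : Y w + C <= (jw w).+1%:R / M by rewrite ler_pdivlMr// ltW.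
    have -> : (jw w).+1%:R / M = (jw w)%:R / M + M^-1 by rewrite -natr1 mulrDl mul1r.
    by set q := (jw w)%:R / M; set p := M^-1; lra.
  have : (jw w)%:R / M <= Y w + C by rewrite ler_pdivrMr.
  by set q := (jw w)%:R / M; lra.
have m1 j : measurable_fun [set: T] (\1_(A j) : T -> R).
  by apply: measurable_indic; exact: Gm.
have iXA j : intg (fun w => X w * \1_(A j) w).
  apply: (@integrable_mul_bounded _ _ 1) => // w.
  by rewrite ger0_norm// indicE lern1 leq_b1.
have iXYm : intg (fun w => X w * Ym w).
  have -> : (fun w => X w * Ym w) =
     (fun w => \sum_(0 <= j < K) (j%:R / M - C) * (X w * \1_(A j) w)).
    apply/funext => w; rewrite mulr_sumr; apply: eq_bigr => j _; ring.
  by apply: integrable_sum_nat => j _; exact: integrable_scaleR.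
have XYm0 : \int[P]_w (X w * Ym w) = 0.
  transitivity (\int[P]_w (\sum_(0 <= j < K) (j%:R / M - C) * (X w * \1_(A j) w))).
    apply: eq_Rintegral => w _; rewrite mulr_sumr; apply: eq_bigr => j _; ring.
  rewrite Rintegral_sum_nat => [|j _]; last exact: integrable_scaleR.
  apply: big1 => j _; rewrite RintegralZl// (_ : \int[P]_w _ = 0) ?mulr0//.
  transitivity (\int[P]_(w in A j) X w); last exact: X0.
  rewrite [RHS]Rintegral_mkcond; apply: eq_Rintegral => w _.
  by rewrite patchE indicE; case: ifP; rewrite ?mulr1 ?mulr0.
have -> : \int[P]_w (X w * Y w) = \int[P]_w (X w * Y w - X w * Ym w).
  by rewrite RintegralB// XYm0 subr0.
have iB := integrable_subR iXY iXYm.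
apply: (le_trans (le_normr_Rintegral measurableT iB)).
rewrite -RintegralZl//; last exact: integrable_normR.
apply: le_Rintegral => //; first exact: integrable_normR.
  by apply: integrable_scaleR; exact: integrable_normR.
by move=> w _; rewrite -mulrBr normrM mulrC ler_wpM2r.
Qed.

Lemma integrable_sqr_add f g :
  measurable_fun [set: T] f -> measurable_fun [set: T] g ->
  intg (fun w => f w ^+ 2) -> intg (fun w => g w ^+ 2) ->
  intg (fun w => (f w + g w) ^+ 2).
Proof.
move=> mf mg fi gi.
apply: (integrable_dominated _ (integrable_scaleR 2 (integrable_addR fi gi))).
  by apply: measurable_funX; exact: measurable_funD.
by move=> w; rewrite ger0_norm ?sqr_ge0//; have := sqr_ge0 (f w - g w); nra.
Qed.

Lemma measurable_sum_nat (d' : measure_display) (U : measurableType d')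
    (f : nat -> U -> R) m n :
  (forall k, (m <= k < n)%N -> measurable_fun [set: U] (f k)) ->
  measurable_fun [set: U] (fun w => \sum_(m <= k < n) f k w).
Proof.
(* Terms outside the range are set to zero, so that every term of the family is measurable. *)
move=> mf; have -> : (fun w => \sum_(m <= k < n) f k w) =
    (fun w => \sum_(m <= k < n) (if (m <= k < n)%N then f k w else 0)).
  by apply/funext => w; apply: eq_big_nat => k ->.
by apply: measurable_sum => k; case: (boolP (m <= k < n)%N) => [/mf//|_]; exact: measurable_cst.
Qed.

Lemma integrable_sqr_sum_nat (f : nat -> T -> R) n :
  (forall k, (1 <= k < n.+1)%N -> measurable_fun [set: T] (f k)) ->
  (forall k, (1 <= k < n.+1)%N -> intg (fun w => f k w ^+ 2)) ->
  intg (fun w => (\sum_(1 <= k < n.+1) f k w) ^+ 2).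
Proof.
elim: n => [_ _|n IH mf fi].
  rewrite (_ : (fun w => _) = fun=> 0); first exact: integrable_cstR.
  by apply/funext => w; rewrite big_geq// expr0n.
rewrite (_ : (fun w => _) = fun w => (\sum_(1 <= k < n.+1) f k w + f n.+1 w) ^+ 2).
  have nk k : (1 <= k < n.+1 -> 1 <= k < n.+2)%N by move=> /andP[-> /ltnW].
  apply: integrable_sqr_add.
  - by apply: measurable_sum_nat => k /nk; exact: mf.
  - by apply: mf; rewrite /= ltnS.
  - by apply: IH => k /nk; [exact: mf|exact: fi].
  - by apply: fi; rewrite /= ltnS.
by apply/funext => w; rewrite big_nat_recr.
Qed.

Lemma measurable_sin_capexp (d' : measure_display) (U : measurableType d')
    (f g : U -> R) a c :
  measurable_fun [set: U] f -> measurable_fun [set: U] g ->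
  measurable_fun [set: U] (fun w => sin (a + f w) * capexp c (g w)).
Proof.
move=> mf mg; apply: measurable_funM.
  apply: (measurableT_comp (f := sin)); last exact: measurable_funD.
  by apply: continuous_measurable_fun; exact: continuous_sin.
apply: (measurableT_comp (f := expR)); first exact: measurable_expR.
by apply: measurable_funM => //; exact: measurable_minr.
Qed.

Lemma sin_capexp_bounded a c x v : `|sin (a + x) * capexp c v| <= expR (c / 2) :> R.
Proof.
rewrite normrM -[leRHS]mul1r ler_pM// ?sin_max//.
by rewrite ger0_norm ?capexp_ge0// capexp_le.
Qed.

End real_integration.

(** * The real martingale estimate *)

Section real_martingale.
Context {R : realType} {d : measure_display} {T : measurableType d}.
Variable P : probability T R.
Local Notation intg f := (P.-integrable [set: T] (EFin \o f)).
(** [a n] and [b n] play the real and imaginary parts of [Z_n], and [Gen n] generates the events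
    known strictly before time [n]: the hypotheses make [a k], [b k] measurable for it when [k < n],
    and give [a n], [b n] zero integral over its events. *)
Variables (N : nat) (a b : nat -> T -> R) (Gen : nat -> set (set T)).

Hypothesis GenT : forall n A, (1 <= n < N.+1)%N -> <<s Gen n >> A -> measurable A.
Hypothesis Gen_a : forall n k, (1 <= k < n)%N -> (n < N.+1)%N ->
  measurable_fun [set: g_sigma_algebraType (Gen n)] (a k : g_sigma_algebraType (Gen n) -> R).
Hypothesis Gen_b : forall n k, (1 <= k < n)%N -> (n < N.+1)%N ->
  measurable_fun [set: g_sigma_algebraType (Gen n)] (b k : g_sigma_algebraType (Gen n) -> R).
Hypothesis ia : forall n, (1 <= n < N.+1)%N -> intg (a n).
Hypothesis ib : forall n, (1 <= n < N.+1)%N -> intg (b n).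
Hypothesis a0 : forall n A, (1 <= n < N.+1)%N -> <<s Gen n >> A -> \int[P]_(w in A) a n w = 0.
Hypothesis b0 : forall n A, (1 <= n < N.+1)%N -> <<s Gen n >> A -> \int[P]_(w in A) b n w = 0.

(** With [z = a + i b]: [q] is [|z| ^+ 2], while [A] and [D] sum [2 Re (z ^+ 2)] and
    [2 Im (z ^+ 2)]. Thus [Phi phi] sums [2 Re (exp (- i phi) z ^+ 2)], the real form of the phase
    sum. *)
Let q n w := a n w ^+ 2 + b n w ^+ 2.
Let Q w := \sum_(1 <= n < N.+1) q n w.
Let A w := \sum_(1 <= n < N.+1) 2 * (a n w ^+ 2 - b n w ^+ 2).
Let D w := \sum_(1 <= n < N.+1) 4 * (a n w * b n w).
Let Phi phi w := cos phi * A w + sin phi * D w.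

Hypothesis i4 : forall n, (1 <= n < N.+1)%N -> intg (fun w => q n w ^+ 2).

Let ma n : (1 <= n < N.+1)%N -> measurable_fun [set: T] (a n).
Proof. by move=> /ia; exact: integrable_measurable. Qed.

Let mb n : (1 <= n < N.+1)%N -> measurable_fun [set: T] (b n).
Proof. by move=> /ib; exact: integrable_measurable. Qed.

Let mq n : (1 <= n < N.+1)%N -> measurable_fun [set: T] (q n).
Proof.
move=> nN; apply: measurable_funD; apply: measurable_funX; [exact: ma|exact: mb].
Qed.

Let mQ1 : measurable_fun [set: T] (fun w => Q w - 1).
Proof.
by apply: measurable_funB => //; apply: measurable_sum_nat => n; exact: mq.
Qed.

Let mA : measurable_fun [set: T] A.
Proof.
apply: measurable_sum_nat => n nN; apply: measurable_funM => //.
by apply: measurable_funB; apply: measurable_funX; [exact: ma|exact: mb].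
Qed.

Let mD : measurable_fun [set: T] D.
Proof.
apply: measurable_sum_nat => n nN; apply: measurable_funM => //.
by apply: measurable_funM; [exact: ma|exact: mb].
Qed.

Lemma integrable_sqr_Q1 : intg (fun w => (Q w - 1) ^+ 2).
Proof.
apply: (@integrable_sqr_add _ _ _ P Q (fun=> - 1)) => //.
- by apply: measurable_sum_nat => n; exact: mq.
- by apply: integrable_sqr_sum_nat => n; [exact: mq|exact: i4].
- exact: integrable_cstR.
Qed.

Let iA2 : intg (fun w => A w ^+ 2).
Proof.
apply: integrable_sqr_sum_nat => n nN.
  apply: measurable_funM => //.
  by apply: measurable_funB; apply: measurable_funX; [exact: ma|exact: mb].
apply: (integrable_dominated _ (integrable_scaleR 4 (i4 nN))).
  apply: measurable_funX; apply: measurable_funM => //.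
  by apply: measurable_funB; apply: measurable_funX; [exact: ma|exact: mb].
move=> w; rewrite ger0_norm ?sqr_ge0// /q.
have := mulr_ge0 (sqr_ge0 (a n w)) (sqr_ge0 (b n w)); nra.
Qed.

Let iD2 : intg (fun w => D w ^+ 2).
Proof.
apply: integrable_sqr_sum_nat => n nN.
  by apply: measurable_funM => //; apply: measurable_funM; [exact: ma|exact: mb].
apply: (integrable_dominated _ (integrable_scaleR 4 (i4 nN))).
  apply: measurable_funX; apply: measurable_funM => //.
  by apply: measurable_funM; [exact: ma|exact: mb].
move=> w; rewrite ger0_norm ?sqr_ge0// /q.
have := sqr_ge0 (a n w ^+ 2 - b n w ^+ 2); nra.
Qed.

Let iAD : intg (fun w => A w * D w).
Proof. exact: integrable_mul_sqr. Qed.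

Let mPhi phi : measurable_fun [set: T] (Phi phi).
Proof. by apply: measurable_funD; apply: measurable_funM. Qed.

Let Phi2E phi : (fun w => Phi phi w ^+ 2) = (fun w =>
   (cos phi ^+ 2 * (A w ^+ 2) + (2 * (cos phi * sin phi)) * (A w * D w))
   + sin phi ^+ 2 * (D w ^+ 2)).
Proof. by apply/funext => w; rewrite /Phi; ring. Qed.

Lemma integrable_sqr_Phi phi : intg (fun w => Phi phi w ^+ 2).
Proof.
rewrite Phi2E; apply: integrable_addR; last exact: integrable_scaleR.
by apply: integrable_addR; exact: integrable_scaleR.
Qed.

(** The second moment of [Phi phi] is a quadratic form in [(cos phi, sin phi)], so its maximum is
    attained. *)
Lemma Phi_max : exists phi0, forall phi,
  \int[P]_w (Phi phi w ^+ 2) <= \int[P]_w (Phi phi0 w ^+ 2).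
Proof.
have E phi : \int[P]_w (Phi phi w ^+ 2) =
    (\int[P]_w A w ^+ 2) * cos phi ^+ 2 +
    2 * (\int[P]_w (A w * D w)) * (cos phi * sin phi) +
    (\int[P]_w D w ^+ 2) * sin phi ^+ 2.
  rewrite Phi2E RintegralD//; last 2 first.
    by apply: integrable_addR; exact: integrable_scaleR.
    exact: integrable_scaleR.
  rewrite RintegralD//; last 2 first.
    exact: integrable_scaleR.
    exact: integrable_scaleR.
  by rewrite !RintegralZl//; ring.
have [phi0 h] := quadratic_form_max (\int[P]_w A w ^+ 2) (\int[P]_w (A w * D w))
  (\int[P]_w D w ^+ 2).
by exists phi0 => phi; rewrite !E.
Qed.

(** [lam] bounds the fourth root of the fourth-moment sum and is positive so that it can be a
    divisor. [M] bounds the phase term at all angles because the angle used depends on [t1] and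
    [t2]. *)
Lemma cos_martingale_approx (s t1 t2 lam M : R) :
  0 < lam <= 1 -> \sum_(1 <= n < N.+1) \int[P]_w (q n w ^+ 2) <= lam ^+ 4 ->
  (forall phi, Num.sqrt (\int[P]_w (Phi phi w ^+ 2)) <= M) ->
  let t := (t1 ^+ 2 + t2 ^+ 2) / 2 in
  (`|\int[P]_w cos (s + \sum_(1 <= n < N.+1) (t1 * a n w + t2 * b n w))
    - expR (- (t / 2)) * cos s| <=
  expR t * (54 * lam + 11 * Num.sqrt (\int[P]_w ((Q w - 1) ^+ 2)) + 5 / 2 * M) : Prop).
Proof.
move=> /andP[lam0 lam1] Llam hM t.
have tdef : t = (t1 ^+ 2 + t2 ^+ 2) / 2 by []; clearbody t.
set B := Num.sqrt (\int[P]_w ((Q w - 1) ^+ 2)).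
have t0 : 0 <= t by rewrite tdef divr_ge0// addr_ge0// sqr_ge0.
pose X n w := t1 * a n w + t2 * b n w.
pose Y n w := sin (s + \sum_(1 <= j < n) X j w) *
  capexp (2 * t) (\sum_(1 <= j < n) X j w ^+ 2).
(* [phi] is the argument of [(t1 + i t2) ^+ 2 / 2], whose modulus is [t]. At this angle the
   quadratic variation splits as in [VE]. *)
have [phi [tc ts]] := polar_angle ((t1 ^+ 2 - t2 ^+ 2) / 2) (t1 * t2).
have st : Num.sqrt (((t1 ^+ 2 - t2 ^+ 2) / 2) ^+ 2 + (t1 * t2) ^+ 2) = t.
  have -> : ((t1 ^+ 2 - t2 ^+ 2) / 2) ^+ 2 + (t1 * t2) ^+ 2 = t ^+ 2.
    by rewrite tdef; field.
  by rewrite sqrtr_sqr ger0_norm.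
rewrite st in tc ts.
have VE w : \sum_(1 <= n < N.+1) X n w ^+ 2 - t = t * (Q w - 1) + t / 2 * Phi phi w.
  have -> : \sum_(1 <= n < N.+1) X n w ^+ 2 = t * Q w + t / 2 * Phi phi w.
    have -> : t / 2 * Phi phi w = (t * cos phi) / 2 * A w + (t * sin phi) / 2 * D w.
      by rewrite /Phi; field.
    rewrite -tc -ts /Q /A /D !mulr_sumr -!big_split/=.
    by apply: eq_bigr => n _; rewrite /X /q tdef; field.
  by ring.
have X2 n w : X n w ^+ 2 <= 2 * t * q n w.
  have -> : 2 * t = t1 ^+ 2 + t2 ^+ 2 by rewrite tdef; field.
  by rewrite /X /q; have := sqr_ge0 (t1 * b n w - t2 * a n w); nra.
have q0 n w : 0 <= q n w by rewrite addr_ge0// sqr_ge0.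
have X3 n w : `|X n w| ^+ 3 <= lam * t * q n w + 2 * t ^+ 2 / lam * q n w ^+ 2.
  set x := X n w; have x2 := X2 n w; rewrite -/x in x2.
  have h1 : lam * (x ^+ 2) <= lam * (2 * t * q n w) by rewrite ler_wpM2l// ltW.
  have h2 : (x ^+ 2) ^+ 2 <= (2 * t * q n w) ^+ 2.
    have tq0 : 0 <= 2 * t * q n w by apply: mulr_ge0; [exact: mulr_ge0|exact: q0].
    by apply: lerXn2r; rewrite ?nnegrE// sqr_ge0.
  have h3 : (x ^+ 2) ^+ 2 / lam <= (2 * t * q n w) ^+ 2 / lam.
    by rewrite ler_wpM2r// invr_ge0 ltW.
  have h4 : `|x| ^+ 3 <= (lam * x ^+ 2 + (x ^+ 2) ^+ 2 / lam) / 2.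
    rewrite -(real_normK (num_real x)).
    have -> : (lam * `|x| ^+ 2 + (`|x| ^+ 2) ^+ 2 / lam) / 2 =
       `|x| ^+ 3 + `|x| ^+ 2 * (lam - `|x|) ^+ 2 / lam / 2 by field; rewrite gt_eqF.
    by rewrite lerDl !divr_ge0 ?(ltW lam0)// mulr_ge0// sqr_ge0.
  have -> : 2 * t ^+ 2 / lam * q n w ^+ 2 = (2 * t * q n w) ^+ 2 / lam / 2.
    by field; rewrite gt_eqF.
  by lra.
(* The cubic term [3 |X| ^+ 3] contributes [3 lam t Q] and the coefficient [k2]; [Q <= 1 + |Q - 1|]
   divides the former between [k0] and [k1]. The rest of [k1], and [k3], come from [5 / 2 * |V - t|]
   through [VE]. *)
pose k0 := 3 * lam * t; pose k1 := 3 * lam * t + 5 / 2 * t.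
pose k2 := 6 * t ^+ 2 / lam; pose k3 := 5 / 4 * t.
pose G w := ((k0 + k1 * `|Q w - 1|) + k2 * \sum_(1 <= n < N.+1) (q n w ^+ 2))
   + k3 * `|Phi phi w|.
pose Dl w := (expR (t / 2) * cos (s + \sum_(1 <= n < N.+1) X n w) - cos s)
    + \sum_(1 <= n < N.+1) X n w * Y n w.
have DG w : `|Dl w| <= expR t * G w.
  apply: (le_trans (cos_sum_approx s (X ^~ w) N t0)).
  rewrite ler_wpM2l ?expR_ge0// VE.
  have h1 : \sum_(1 <= n < N.+1) `|X n w| ^+ 3 <=
      lam * t * Q w + 2 * t ^+ 2 / lam * \sum_(1 <= n < N.+1) (q n w ^+ 2).
    by rewrite /Q !mulr_sumr -big_split/=; apply: ler_sum => n _; exact: X3.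
  have h2 : `|t * (Q w - 1) + t / 2 * Phi phi w| <=
      t * `|Q w - 1| + t / 2 * `|Phi phi w|.
    have t20 : 0 <= t / 2 by rewrite divr_ge0.
    rewrite (le_trans (ler_normD _ _))// (normrM t) (normrM (t / 2)).
    by rewrite (ger0_norm t0) (ger0_norm t20).
  have h3 : lam * t * Q w <= lam * t * (1 + `|Q w - 1|).
    rewrite ler_wpM2l ?mulr_ge0 ?(ltW lam0)//.
    by rewrite -lerBlDl ler_norm.
  rewrite /G /k0 /k1 /k2 /k3.
  have -> : 6 * t ^+ 2 / lam = 3 * (2 * t ^+ 2 / lam) by ring.
  move: h1; set z := 2 * t ^+ 2 / lam * _ => h1.
  have -> : 3 * (2 * t ^+ 2 / lam) * \sum_(1 <= n < N.+1) q n w ^+ 2 = 3 * z.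
    by rewrite /z; ring.
  move: h1 h2 h3; set y := lam * t * Q w; set u := `|Q w - 1|; set v := `|Phi phi w|.
  move: (\sum_(1 <= n < N.+1) `|X n w| ^+ 3) (`|_|) => x3 x4 h1 h2 h3.
  by lra.
have iX n : (1 <= n < N.+1)%N -> intg (X n).
  by move=> nN; apply: integrable_addR; apply: integrable_scaleR; [exact: ia|exact: ib].
have mX n : (1 <= n < N.+1)%N -> measurable_fun [set: T] (X n).
  by move=> /iX; exact: integrable_measurable.
have GX n k : (1 <= k < n)%N -> (n < N.+1)%N ->
    measurable_fun [set: g_sigma_algebraType (Gen n)]
      (X k : g_sigma_algebraType (Gen n) -> R).
  move=> kn nN; apply: measurable_funD; apply: measurable_funM => //.
    exact: Gen_a.
  exact: Gen_b.
have GY n : (1 <= n < N.+1)%N ->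
    measurable_fun [set: g_sigma_algebraType (Gen n)]
      (Y n : g_sigma_algebraType (Gen n) -> R).
  move=> /andP[n1 nN]; apply: measurable_sin_capexp.
    by apply: measurable_sum_nat => k kn; exact: GX.
  by apply: measurable_sum_nat => k kn; apply: measurable_funX; exact: GX.
have mY n : (1 <= n < N.+1)%N -> measurable_fun [set: T] (Y n).
  by move=> nN _ E mE; apply: (GenT nN); exact: (GY n nN measurableT E mE).
have Yb n w : `|Y n w| <= expR (2 * t / 2) by exact: sin_capexp_bounded.
have iXY n : (1 <= n < N.+1)%N -> intg (fun w => X n w * Y n w).
  by move=> nN; apply: integrable_mul_bounded (iX n nN) (mY n nN) (Yb n).
(* [Y n] is bounded and measurable with respect to the past, so the martingale difference [X n] is
   orthogonal to it. *)
have XY0 n : (1 <= n < N.+1)%N -> \int[P]_w (X n w * Y n w) = 0.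
  move=> nN; apply: (@Rintegral_mul_eq0 _ _ _ P (Gen n) _ _ (expR (2 * t / 2))) => //.
  - by move=> E; exact: GenT.
  - exact: iX.
  - move=> E GE; have mE := GenT nN GE.
    have iaE : P.-integrable E (EFin \o (a n)) by apply: integrableS (ia nN).
    have ibE : P.-integrable E (EFin \o (b n)) by apply: integrableS (ib nN).
    rewrite RintegralD//; last 2 first.
      exact: (integrableZl mE t1 iaE).
      exact: (integrableZl mE t2 ibE).
    by rewrite !RintegralZl// a0// b0// !mulr0 addr0.
  - exact: GY.
have mS : measurable_fun [set: T] (fun w => cos (s + \sum_(1 <= n < N.+1) X n w)).
  apply: (measurableT_comp (f := cos)).
    by apply: continuous_measurable_fun; exact: continuous_cos.
  by apply: measurable_funD => //; exact: measurable_sum_nat.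
have iS : intg (fun w => cos (s + \sum_(1 <= n < N.+1) X n w)).
  by apply: (integrable_dominated mS (integrable_cstR P 1)) => w; exact: cos_max.
have iSX : intg (fun w => \sum_(1 <= n < N.+1) X n w * Y n w).
  exact: integrable_sum_nat.
have iE : intg (fun w => expR (t / 2) * cos (s + \sum_(1 <= n < N.+1) X n w) - cos s).
  by apply: integrable_subR; [exact: integrable_scaleR|exact: integrable_cstR].
have iDl : intg Dl by exact: integrable_addR.
have Q1 := Rintegral_norm_le_sqrt mQ1 integrable_sqr_Q1.
have Ph1 := Rintegral_norm_le_sqrt (mPhi phi) (integrable_sqr_Phi phi).
have iQn := integrable_normR Q1.1.
have iPn := integrable_normR Ph1.1.
have iq2 : intg (fun w => \sum_(1 <= n < N.+1) q n w ^+ 2) by exact: integrable_sum_nat.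
have iG1 : intg (fun w => k0 + k1 * `|Q w - 1|).
  by apply: integrable_addR; [exact: integrable_cstR|exact: integrable_scaleR].
have iG2 : intg (fun w => (k0 + k1 * `|Q w - 1|) + k2 * \sum_(1 <= n < N.+1) (q n w ^+ 2)).
  by apply: integrable_addR => //; exact: integrable_scaleR.
have iG : intg G by apply: integrable_addR => //; exact: integrable_scaleR.
set I := \int[P]_w cos _.
have DlE : \int[P]_w Dl w = expR (t / 2) * I - cos s.
  rewrite RintegralD// RintegralB//; last 2 first.
    exact: integrable_scaleR.
    exact: integrable_cstR.
  rewrite RintegralZl// Rintegral_prob_cst Rintegral_sum_nat//.
  by rewrite big_nat big1 ?addr0// => n nN; exact: XY0.
have GE : \int[P]_w G w <= k0 + k1 * B + k2 * lam ^+ 4 + k3 * M.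
  have lt0 : 0 <= lam * t by rewrite mulr_ge0// ltW.
  rewrite RintegralD//; last exact: integrable_scaleR.
  rewrite RintegralD//; last exact: integrable_scaleR.
  rewrite RintegralD//; last 2 first.
    exact: integrable_cstR.
    exact: integrable_scaleR.
  rewrite Rintegral_prob_cst !RintegralZl// Rintegral_sum_nat//.
  apply: lerD; last first.
    have k30 : 0 <= k3 by rewrite /k3; lra.
    rewrite ler_wpM2l//; exact: le_trans Ph1.2 (hM phi).
  apply: lerD; last first.
    by rewrite ler_wpM2l// /k2 divr_ge0 ?(ltW lam0)// mulr_ge0// sqr_ge0.
  have k10 : 0 <= k1 by rewrite /k1; lra.
  by rewrite lerD2l ler_wpM2l//; exact: Q1.2.
have main : `|expR (t / 2) * I - cos s| <= expR t * (k0 + k1 * B + k2 * lam ^+ 4 + k3 * M).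
  rewrite -DlE; apply: (le_trans (le_normr_Rintegral measurableT iDl)).
  apply: (@le_trans _ _ (\int[P]_w (expR t * G w))).
    apply: le_Rintegral => //; first exact: integrable_normR.
    exact: integrable_scaleR.
  by rewrite RintegralZl// ler_wpM2l// expR_ge0.
(* Dividing by [E] turns the prefactor [exp t] into [E], so one factor [E] remains available to
   absorb [t] and [t ^+ 2] while keeping the final bound of order [exp t]. *)
set E := expR (t / 2) in main *.
have E0 : 0 < E by exact: expR_gt0.
have EE : expR t = E * E by rewrite -expRD; congr expR; field.
have EV : expR (- (t / 2)) * E = 1 by rewrite -expRD addNr expR0.
have tE : t <= 2 * E by have := expR_ge1Dx (t / 2); rewrite -/E; lra.
have t2E : t ^+ 2 <= 8 * E.
  have := @expR_ge1Dxn R (t / 2) 1 _; rewrite -/E.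
  have -> : (2`!%:R : R) = 2 by [].
  have -> : (t / 2) ^+ 2 / 2 = t ^+ 2 / 8 by field.
  by move=> /(_ (divr_ge0 t0 (ler0n _ _))); lra.
have B0 : 0 <= B by exact: sqrtr_ge0.
have M0 : 0 <= M by apply: le_trans (hM 0); exact: sqrtr_ge0.
(* From [t <= 2 E], [t ^+ 2 <= 8 E] and [lam <= 1]: [54 = 3 * 2 + 6 * 8], [11 = (3 + 5 / 2) * 2] and
   [5 / 2 = 5 / 4 * 2]. *)
have kE : k0 + k1 * B + k2 * lam ^+ 4 + k3 * M <= E * (54 * lam + 11 * B + 5 / 2 * M).
  have -> : E * (54 * lam + 11 * B + 5 / 2 * M) =
    6 * (E * lam) + 11 * (E * B) + 48 * (E * lam) + 5 / 2 * (E * M) by ring.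
  have e1 : t * lam <= 2 * E * lam by rewrite ler_wpM2r// ltW.
  have e2 : t * B <= 2 * E * B by rewrite ler_wpM2r.
  have e3 : t * M <= 2 * E * M by rewrite ler_wpM2r.
  have e4 : lam * (t * B) <= 1 * (t * B) by rewrite ler_wpM2r// mulr_ge0.
  have e5 : t ^+ 2 * lam ^+ 3 <= 8 * E * lam.
    rewrite ler_pM ?sqr_ge0 ?exprn_ge0 ?(ltW lam0)//.
    by rewrite exprS ler_piMr ?(ltW lam0)// exprn_ile1// ltW.
  have e6 : k2 * lam ^+ 4 = 6 * (t ^+ 2 * lam ^+ 3).
    by rewrite /k2; field; rewrite gt_eqF.
  rewrite e6 /k0 /k1 /k3; lra.
have -> : I - expR (- (t / 2)) * cos s = expR (- (t / 2)) * (E * I - cos s).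
  by rewrite mulrBr mulrA EV mul1r.
rewrite normrM ger0_norm ?expR_ge0//.
apply: (le_trans (ler_wpM2l (expR_ge0 _) main)).
move: kE; set K := _ + k3 * M; set L := _ + 5 / 2 * M => kE.
by rewrite EE mulrA mulrA EV mul1r -mulrA ler_wpM2l// ltW.
Qed.

End real_martingale.

(** * Complex martingale differences *)

Section complex_moduli.
Context {R : realType}.
Implicit Types z : R[i].

Lemma modc_sqr z : modc z ^+ 2 = complex.Re z ^+ 2 + complex.Im z ^+ 2.
Proof. by case: z => x y; rewrite /modc/= sqr_sqrtr// addr_ge0// sqr_ge0. Qed.

Lemma modc_exp4 z : modc z ^+ 4 = (complex.Re z ^+ 2 + complex.Im z ^+ 2) ^+ 2.
Proof. by rewrite -modc_sqr -exprM. Qed.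

Lemma modc_le (x y : R) : modc (x +i* y) <= `|x| + `|y|.
Proof.
rewrite /modc/= -[leRHS]ger0_norm ?addr_ge0// -sqrtr_sqr ler_wsqrtr//.
rewrite -(real_normK (num_real x)) -(real_normK (num_real y)).
by have := mulr_ge0 (normr_ge0 x) (normr_ge0 y); nra.
Qed.

Lemma expC_imag (x : R) : expC x*i = cos x +i* sin x.
Proof. by rewrite /expC/= expR0 mul1r. Qed.

Lemma Re_sum (f : nat -> R[i]) m n :
  complex.Re (\sum_(m <= k < n) f k) = \sum_(m <= k < n) complex.Re (f k).
Proof. by apply: (big_morph (@complex.Re R)) => // -[x y] [u v]. Qed.

Lemma Im_sum (f : nat -> R[i]) m n :
  complex.Im (\sum_(m <= k < n) f k) = \sum_(m <= k < n) complex.Im (f k).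
Proof. by apply: (big_morph (@complex.Im R)) => // -[x y] [u v]. Qed.

(** The two terms are complex conjugates, so the sum is [2 Re (exp (- i phi) z ^+ 2)]. *)
Lemma phase_summand (phi : R) z :
  expC (- phi)*i * z ^+ 2 + expC phi*i * conjc z ^+ 2 =
  (cos phi * (2 * (complex.Re z ^+ 2 - complex.Im z ^+ 2))
   + sin phi * (4 * (complex.Re z * complex.Im z)))%:C.
Proof.
case: z => x y; rewrite !expC_imag cosN sinN !expr2 /=.
apply/eqP; rewrite eq_complex/=; apply/andP; split; apply/eqP; ring.
Qed.

End complex_moduli.

Section complex_expectation.
Context {R : realType} {d : measure_display} {T : measurableType d}.
Variable P : probability T R.

Lemma fine_expectation (f : T -> R) : fine 'E_P[f] = \int[P]_w f w.
Proof. by rewrite unlock. Qed.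

Lemma phase_termE (N : nat) (Z : nat -> T -> R[i]) (phi : R) :
  phase_term P N Z phi = Num.sqrt (\int[P]_w
   ((cos phi * (\sum_(1 <= n < N.+1)
                 2 * (complex.Re (Z n w) ^+ 2 - complex.Im (Z n w) ^+ 2))
    + sin phi * (\sum_(1 <= n < N.+1)
                 4 * (complex.Re (Z n w) * complex.Im (Z n w)))) ^+ 2)).
Proof.
rewrite /phase_term /cexpectation/= fine_expectation; congr Num.sqrt.
apply: eq_Rintegral => w _ /=.
under eq_bigr do rewrite phase_summand.
by rewrite -rmorph_sum -rmorphXn/= big_split/= !mulr_sumr.
Qed.

(** Needed for [Z_1], whose past is empty: there the conditional mean-zero property has to come from
    the plain expectation. *)
Lemma trivial_sigma_algebra (A : set T) :
  <<s (set0 : set (set T)) >> A -> A = set0 \/ A = setT.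
Proof.
apply: (@smallest_sub _ (sigma_algebra setT) _ [set A | A = set0 \/ A = setT]) => //.
split=> [|B [] ->|F FP]; first by left.
- by right; rewrite setD0.
- by left; rewrite setDT.
- have [[n Fn]|nF] := pselect (exists n, F n = setT).
    by right; apply/seteqP; split=> // w _; exists n; rewrite ?Fn.
  left; apply/seteqP; split=> // w [n _].
  by have [->//|Fn] := FP n; case: nF; exists n.
Qed.

(* [<<s past Z n >>] is [sigma_upto Z n.-1]; for [n = 1] it is trivial. *)
Definition past (Z : nat -> T -> R[i]) (n : nat) : set (set T) :=
  \bigcup_(k in [set k | (1 <= k <= n.-1)%N]) cpreimages (Z k).

Variables (N : nat) (Z : nat -> T -> R[i]).
Hypothesis mdZ : martingale_difference P N Z.

Lemma martingale_difference_cintegrable n :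
  (1 <= n < N.+1)%N -> cintegrable P (Z n).
Proof. by case: mdZ => h _ _; rewrite ltnS; exact: h. Qed.

Lemma past_measurable n A : (1 <= n < N.+1)%N -> <<s past Z n >> A -> measurable A.
Proof.
move=> nN; apply: smallest_sub A; first exact: sigma_algebra_measurable.
move=> A [k /= /andP[k1 kn]].
have [|iR iI] := martingale_difference_cintegrable (n := k).
  by rewrite k1/= ltnS (leq_trans kn)// (leq_trans (leq_pred _))//; case/andP: nN.
have mR := integrable_measurable iR; have mI := integrable_measurable iI.
by case=> -[B mB <-]; [exact: mR|exact: mI].
Qed.

Lemma past_measurable_Re n k : (1 <= k < n)%N ->
  measurable_fun [set: g_sigma_algebraType (past Z n)]
    (@complex.Re R \o Z k : g_sigma_algebraType (past Z n) -> R).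
Proof.
move=> /andP[k1 kn] _ B mB; apply: sub_sigma_algebra; exists k => /=.
  by rewrite k1/= -ltnS (ltn_predK kn).
by left; exists B.
Qed.

Lemma past_measurable_Im n k : (1 <= k < n)%N ->
  measurable_fun [set: g_sigma_algebraType (past Z n)]
    (@complex.Im R \o Z k : g_sigma_algebraType (past Z n) -> R).
Proof.
move=> /andP[k1 kn] _ B mB; apply: sub_sigma_algebra; exists k => /=.
  by rewrite k1/= -ltnS (ltn_predK kn).
by right; exists B.
Qed.

Lemma cintegral_past n A : (1 <= n < N.+1)%N -> <<s past Z n >> A ->
  cintegral P A (Z n) = 0.
Proof.
case: n => // -[_|n /andP[_ nN]] GA; last first.
  have [_ _ /(_ n.+1)] := mdZ; rewrite /= -ltnS.
  have -> : (n.+1 < N.-1.+1)%N by move: nN; case: (N).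
  move=> /(_ isT)[_ _ _ /(_ A GA) <-].
  by rewrite /cintegral /= /Rintegral integral0.
(* At [n = 1] only the empty set and the whole space occur, and over the latter the integral is the
   expectation of [Z_1]. *)
have p0 : past Z 1 = set0.
  by apply/seteqP; split=> // B [k /=]; case: k.
rewrite p0 in GA; have [->|->] := trivial_sigma_algebra GA.
  by rewrite /cintegral !Rintegral_set0.
by have [_ + _] := mdZ; rewrite /cexpectation !fine_expectation.
Qed.

Hypothesis Z4 : forall n, (1 <= n <= N)%N ->
  ('E_P[fun w => (modc (Z n w) ^+ 4)%R] < +oo)%E.

Lemma integrable_modc_exp4 n : (1 <= n < N.+1)%N -> P.-integrable [set: T]
  (EFin \o (fun w => (complex.Re (Z n w) ^+ 2 + complex.Im (Z n w) ^+ 2) ^+ 2)).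
Proof.
move=> nN; have [iR iI] := martingale_difference_cintegrable nN.
have mR := integrable_measurable iR; have mI := integrable_measurable iI.
apply/integrableP; split.
  apply/measurable_EFinP; apply: measurable_funX; apply: measurable_funD;
    by apply: measurable_funX.
have := Z4 nN; rewrite unlock; apply: le_lt_trans.
rewrite le_eqVlt; apply/orP; left; apply/eqP; apply: eq_integral => w _ /=.
by rewrite modc_exp4 ger0_norm ?sqr_ge0.
Qed.

End complex_expectation.

(** * The bound for the complex characteristic function *)

Theorem theorem2p4 (R : realType) :
  exists C1 C2 C3 : R,
  forall (d : measure_display) (T : measurableType d) (P : probability T R)
    (N : nat) (Z : nat -> T -> R[i]),
  (1 <= N)%N ->
  martingale_difference P N Z ->
  (forall n, (1 <= n <= N)%N ->
     ('E_P[fun w => (modc (Z n w) ^+ 4)%R] < +oo)%E) ->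
  exists M : R,
  is_maximum (range (phase_term P N Z)) M /\
  forall t1 t2 : R,
  let S w := \sum_(1 <= n < N.+1) Z n w in
  let tsq := (t1 ^+ 2 + t2 ^+ 2) / 2 in
  modc (cexpectation P (fun w =>
          expC ((t1 * complex.Re (S w))*i + (t2 * complex.Im (S w))*i))
        - (expR (- (tsq / 2)))%:C)
  <= C1 * (expR tsq *
       (\sum_(1 <= n < N.+1) fine 'E_P[fun w => (modc (Z n w) ^+ 4)%R]) `^ 4^-1)
   + C2 * (expR tsq *
       Num.sqrt (fine 'E_P[fun w =>
         (((\sum_(1 <= n < N.+1) modc (Z n w) ^+ 2) - 1) ^+ 2)%R]))
   + C3 * (expR tsq * M).
Proof.
(* Twice the constants 54, 11 and [5 / 2], since real and imaginary parts are estimated separately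
   and added. *)
exists 108, 22, 5 => d T P N Z _ mdZ Z4.
pose a n w := complex.Re (Z n w); pose b n w := complex.Im (Z n w).
have ia n (nN : (1 <= n < N.+1)%N) : P.-integrable [set: T] (EFin \o a n).
  exact: (martingale_difference_cintegrable mdZ nN).1.
have ib n (nN : (1 <= n < N.+1)%N) : P.-integrable [set: T] (EFin \o b n).
  exact: (martingale_difference_cintegrable mdZ nN).2.
have a0 n A (nN : (1 <= n < N.+1)%N) (GA : <<s past Z n >> A) :
    \int[P]_(w in A) a n w = 0.
  by have := cintegral_past mdZ nN GA => /(congr1 (@complex.Re R)).
have b0 n A (nN : (1 <= n < N.+1)%N) (GA : <<s past Z n >> A) :
    \int[P]_(w in A) b n w = 0.
  by have := cintegral_past mdZ nN GA => /(congr1 (@complex.Im R)).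
have i4 := integrable_modc_exp4 mdZ Z4.
have [phi0 phi0P] := Phi_max ia ib i4.
pose M := phase_term P N Z phi0.
have Mub phi : phase_term P N Z phi <= M.
  by rewrite /M !phase_termE ler_wsqrtr.
exists M; split.
  by split; [exists phi0|move=> _ [phi _ <-]].
move=> t1 t2; lazy zeta; set tsq := (t1 ^+ 2 + t2 ^+ 2) / 2.
set L := \sum_(1 <= n < N.+1) _.
have LE : L = \sum_(1 <= n < N.+1) \int[P]_w ((a n w ^+ 2 + b n w ^+ 2) ^+ 2).
  apply: eq_bigr => n _; rewrite fine_expectation; apply: eq_Rintegral => w _.
  by rewrite modc_exp4.
have L0 : 0 <= L.
  by rewrite LE sumr_ge0// => n _; apply: Rintegral_ge0 => w _; exact: sqr_ge0.
have BE : fine 'E_P[fun w => (((\sum_(1 <= n < N.+1) modc (Z n w) ^+ 2) - 1) ^+ 2)%R]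
    = \int[P]_w ((\sum_(1 <= n < N.+1) (a n w ^+ 2 + b n w ^+ 2) - 1) ^+ 2).
  rewrite fine_expectation; apply: eq_Rintegral => w _.
  by congr ((_ - _) ^+ 2); apply: eq_bigr => n _; rewrite modc_sqr.
rewrite BE; set B := Num.sqrt _.
have B0 : 0 <= B by exact: sqrtr_ge0.
have M0 : 0 <= M by rewrite /M phase_termE sqrtr_ge0.
pose th w := \sum_(1 <= n < N.+1) (t1 * a n w + t2 * b n w).
have thE w : (t1 * complex.Re (\sum_(1 <= n < N.+1) Z n w))*i + (t2 * complex.Im (\sum_(1 <= n < N.+1) Z n w))*i = (th w)*i.
  apply/eqP; rewrite eq_complex/= addr0 eqxx/=; apply/eqP.
  by rewrite Re_sum Im_sum !mulr_sumr -big_split.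
(* [sin x = cos (- pi / 2 + x)] and [cos (- pi / 2) = 0], so both parts take the form of
   [cos_martingale_approx], the Gaussian term surviving only in the real part. *)
have cE : cexpectation P (fun w =>
      expC ((t1 * complex.Re (\sum_(1 <= n < N.+1) Z n w))*i + (t2 * complex.Im (\sum_(1 <= n < N.+1) Z n w))*i))
    - (expR (- (tsq / 2)))%:C =
    (\int[P]_w cos (0 + th w) - expR (- (tsq / 2)) * cos 0) +i*
    (\int[P]_w cos (- (pi / 2) + th w) - expR (- (tsq / 2)) * cos (- (pi / 2))).
  have -> : (fun w => expC ((t1 * complex.Re (\sum_(1 <= n < N.+1) Z n w))*i
      + (t2 * complex.Im (\sum_(1 <= n < N.+1) Z n w))*i)) =
      (fun w => cos (th w) +i* sin (th w)).
    by apply/funext => w; rewrite thE expC_imag.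
  rewrite /cexpectation !fine_expectation cos0 mulr1 cosN cos_pihalf mulr0.
  apply/eqP; rewrite eq_complex/=; apply/andP; split; apply/eqP.
    congr (_ - _); apply: eq_Rintegral => w _ /=.
    by rewrite add0r.
  congr (_ - _); apply: eq_Rintegral => w _ /=.
  by rewrite cosD cosN sinN cos_pihalf sin_pihalf mul0r add0r mulN1r opprK.
rewrite cE; apply: (le_trans (modc_le _ _)).
have tsq0 : 0 <= tsq by rewrite divr_ge0// addr_ge0// sqr_ge0.
have e1 : 1 <= expR tsq by rewrite -(expR0 R) ler_expR.
have eN1 : expR (- (tsq / 2)) <= 1 by rewrite -[leRHS](expR0 R) ler_expR oppr_le0 divr_ge0.
(* The strict inequality keeps [lam] positive even when [L = 0]. If [lam > 1] the claim is trivial: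
   the left side is at most 2 and the right side at least 54. *)
have approx lam : L `^ 4^-1 < lam -> forall s,
    `|\int[P]_w cos (s + th w) - expR (- (tsq / 2)) * cos s| <=
    expR tsq * (54 * lam + 11 * B + 5 / 2 * M).
  move=> Llam s; have lam0 : 0 < lam by apply: le_lt_trans Llam; exact: powR_ge0.
  have [lam1|lam1] := leP lam 1.
    apply: (cos_martingale_approx (past_measurable mdZ)
      (fun n k kn _ => @past_measurable_Re _ _ _ Z n k kn)
      (fun n k kn _ => @past_measurable_Im _ _ _ Z n k kn) ia ib a0 b0 i4).
    - by rewrite lam0.
    - rewrite -LE.
      have -> : L = (L `^ 4^-1) ^+ 4.
        by rewrite -powR_mulrn ?powR_ge0// -powRrM mulVf ?powRr1.
      by rewrite lerXn2r ?nnegrE ?powR_ge0// ltW.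
    - by move=> phi; have := Mub phi; rewrite phase_termE.
  have mth : measurable_fun [set: T] (fun w => cos (s + th w)).
    apply: (measurableT_comp (f := cos)).
      by apply: continuous_measurable_fun; exact: continuous_cos.
    apply: measurable_funD => //; apply: measurable_sum_nat => n nN.
    apply: measurable_funD; apply: measurable_funM => //.
      exact: integrable_measurable (ia n nN).
    exact: integrable_measurable (ib n nN).
  have icos : P.-integrable [set: T] (EFin \o (fun w => cos (s + th w))).
    by apply: (integrable_dominated mth (integrable_cstR P 1)) => w; exact: cos_max.
  have h1 : `|\int[P]_w cos (s + th w)| <= 1.
    apply: (le_trans (le_normr_Rintegral measurableT icos)).
    rewrite -[leRHS](Rintegral_prob_cst P 1); apply: le_Rintegral => //.
    - exact: integrable_normR.
    - exact: integrable_cstR.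
    - by move=> w _; exact: cos_max.
  have h2 : `|expR (- (tsq / 2)) * cos s| <= 1.
    by rewrite normrM mulr_ile1// ?cos_max// ger0_norm ?expR_ge0.
  apply: (le_trans (ler_normB _ _)).
  have h3 : 1 * 54 <= expR tsq * (54 * lam + 11 * B + 5 / 2 * M).
    by rewrite ler_pM//; lra.
  by lra.
(* Let [lam] decrease to the fourth root of [L]: the excess [e / (108 * E)], multiplied by [54 * E]
   in each of the two parts, adds up to exactly [e]. *)
apply/ler_addgt0Pr => e e0.
set E := expR tsq in e1 approx *.
have E0 : 0 < E by exact: lt_le_trans e1.
have d0 : 0 < e / (108 * E) by rewrite divr_gt0// mulr_gt0.
have h := approx (L `^ 4^-1 + e / (108 * E)).
rewrite ltrDl in h; have {}h := h d0.
apply: (le_trans (lerD (h 0) (h (- (pi / 2))))).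
rewrite le_eqVlt; apply/orP; left; apply/eqP.
by field; rewrite gt_eqF.
Qed.
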